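(* Let $G=(\mathbb{N}_0,w)$ be a physical linear graph. Then: (1) if $G$ satisfies $\mathrm{CD}(0,\infty)$, then $w(n,n+1)\in\mathcal{O}(n)$ as $n\to\infty$; (2) if $G$ satisfies $\mathrm{CD}(K,\infty)$ for some $K<0$, then $w(n,n+1)\in\mathcal{O}(n^2)$ as $n\to\infty$.
   Context: A weighted graph $G=(V,E,w,m)$ is a connected, undirected, simple, locally finite graph $(V,E)$ with vertex weights $m:V\to(0,\infty)$ and symmetric edge weights $w:E\to(0,\infty)$, $w(x,y)=w(y,x)$ (with $w(x,y)=0$ if $x\not\sim y$). It is physical if $m\equiv 1$. A linear graph on $\mathbb{N}_0=\{0,1,2,\dots\}$ has vertex set $V=\mathbb{N}_0$ and edge set $E=\{\{n,n+1\}: n\in\mathbb{N}_0\}$. The Laplacian is $\Delta f(x)=\frac1{m(x)}\sum_{y\sim x}w(x,y)(f(y)-f(x))$ for $f:V\to\mathbb{R}$. Set $\Gamma(f,g)=\frac12(\Delta(fg)-f\Delta g-g\Delta f)$, $\Gamma(f)=\Gamma(f,f)$, and $\Gamma_2(f)=\frac12\Delta\Gamma(f)-\Gamma(f,\Delta f)$. For $K\in\mathbb{R}$, $D\in(0,\infty]$ (with $1/\infty=0$) and $x\in V$, the condition $\mathrm{CD}(K,D,x)$ means $\Gamma_2(f)(x)\ge\frac1D(\Delta f(x))^2+K\,\Gamma(f)(x)$ for all $f:V\to\mathbb{R}$; $\mathrm{CD}(K,D)$ means that $\mathrm{CD}(K,D,x)$ holds for all $x\in V$. *)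

(* Defs.v *)
From HB Require Import structures.
From mathcomp Require Import all_boot all_order all_algebra.
From mathcomp Require Import all_classical all_reals all_analysis.
Import Order.TTheory GRing.Theory Num.Theory.
Import numFieldNormedType.Exports.

Set Implicit Arguments.
Unset Strict Implicit.
Unset Printing Implicit Defensive.

Local Open Scope classical_set_scope.
Local Open Scope ring_scope.

Record weighted_graph (R : realType) (V : choiceType) := WeightedGraph {
  adj : rel V;
  wt : V -> V -> R;
  vm : V -> R;
  adj_sym : symmetric adj;
  adj_irr : irreflexive adj;
  adj_connected : forall x y, exists2 p, path adj x p & last x p = y;
  adj_locally_finite : forall x, finite_set [set y | adj x y];
  wt_sym : forall x y, wt x y = wt y x;
  wt_gt0 : forall x y, adj x y -> 0 < wt x y;
  wt_eq0 : forall x y, ~~ adj x y -> wt x y = 0;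
  vm_gt0 : forall x, 0 < vm x
}.

Section Curvature.
Variables (R : realType) (V : choiceType) (G : weighted_graph R V).
Implicit Types (f g : V -> R) (x y : V).

Definition physical := forall x, vm G x = 1.

Definition laplacian f x : R :=
  (vm G x)^-1 * \sum_(y \in [set y | adj G x y]) wt G x y * (f y - f x).

Definition Gamma f g x : R :=
  2^-1 * (laplacian (fun z => f z * g z) x
          - f x * laplacian g x - g x * laplacian f x).

Definition Gamma2 f x : R :=
  2^-1 * laplacian (Gamma f f) x - Gamma f (laplacian f) x.

(* K is real and D ranges over ]0, +oo]; [inve] gives [+oo^-1 = 0], hence
   [fine D^-1] is 1/D with the convention 1/oo = 0. *)
Definition CD_at (K : R) (D : \bar R) x :=
  forall f, fine (D^-1)%E * laplacian f x ^+ 2 + K * Gamma f f x <= Gamma2 f x.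

Definition CD (K : R) (D : \bar R) := forall x, CD_at K D x.

End Curvature.

Definition linear_graph (R : realType) (G : weighted_graph R nat) :=
  forall i j : nat, adj G i j = (j == i.+1) || (i == j.+1).

(* Main.v *)
(** Write a_n = w(n, n+1), c = -K >= 0 and b_n = a_n + c.  Testing CD(K, oo) at
    n against functions that are affine on each side of n turns it into a
    quadratic form inequality in the two slopes.  The slopes (0, 1) and (1, 0)
    show that consecutive b's differ by a factor of at most 4, and the slopes
    (1/b_(n-1), 1/b_n), combined with the AM-GM inequality, show that
    g_n = sqrt (b_n b_(n+1)) has second differences at most 8c.  Hence g_n is
    O(n) if c = 0 and O(n^2) in general, and a_(n+1) <= b_(n+1) <= 2 g_n. *)
Require Import Defs.
From mathcomp Require Import all_boot all_order all_algebra.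
From mathcomp Require Import all_classical all_reals all_analysis.
From mathcomp Require Import ring lra.
Import Order.TTheory GRing.Theory Num.Theory.
Import numFieldNormedType.Exports.
Local Open Scope classical_set_scope.
Local Open Scope ring_scope.

Lemma laplacian_linear (R : realType) (G : weighted_graph R nat)
    (f : nat -> R) (k : nat) : physical G -> linear_graph G ->
  laplacian G f k.+1 = wt G k.+1 k.+2 * (f k.+2 - f k.+1)
                       + wt G k k.+1 * (f k - f k.+1).
Proof.
move=> hphys hlin; rewrite /laplacian hphys invr1 mul1r.
have -> : [set y | adj G k.+1 y] = [set k.+2] `|` [set k].
  apply/seteqP; split=> y /=; rewrite hlin eqSS.
    by move=> /orP[/eqP ->|/eqP ->]; [left|right].
  by case=> ->; rewrite eqxx ?orbT.
rewrite fsbigU /=; first by rewrite !fsbig_set1 (wt_sym G k.+1 k).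
- exact: finite_set1.
- exact: finite_set1.
- by move=> i [/= -> /eqP]; rewrite gtn_eqF // ltnW.
Qed.

(** Four times the curvature inequality at [m.+2], tested on the function that vanishes there and
    has slope [t] on the left and [u] on the right. Centring at [m.+2] ensures that every Laplacian
    involved sits at a vertex with two neighbours. *)
Lemma CD_slopes (R : realType) (G : weighted_graph R nat) (K u t : R)
    (m : nat) (a := fun n => wt G n n.+1) :
  physical G -> linear_graph G -> CD G K +oo%E ->
  2 * K * (a m.+2 * u ^+ 2 + a m.+1 * t ^+ 2) <=
    a m.+2 * (4 * a m.+2 - a m.+3 - a m.+1) * u ^+ 2
    + a m.+1 * (4 * a m.+1 - a m - a m.+2) * t ^+ 2
    - 4 * a m.+1 * a m.+2 * u * t.
Proof.
move=> hphys hlin hCD.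
pose f (i : nat) : R := if (i <= m.+2)%N then t * (i%:R - m.+2%:R)
                        else u * (i%:R - m.+2%:R).
have := hCD m.+2 f; rewrite /Gamma2 /Gamma !laplacian_linear // -/a.
have -> : f m = - 2 * t by rewrite /f ifT ?(leq_trans (leqnSn m)) //; ring.
have -> : f m.+1 = - t by rewrite /f ifT //; ring.
have -> : f m.+2 = 0 by rewrite /f leqnn subrr mulr0.
have -> : f m.+3 = u by rewrite /f ltnn; ring.
have -> : f m.+4 = 2 * u by rewrite /f ifF; [ring|rewrite ltnNge leqnSn].
rewrite -/(a m) -/(a m.+1) -/(a m.+2) -/(a m.+3) invey /=.
nra.
Qed.

(** Here [w], [x], [y], [z] play the square roots of four consecutive b's. AM-GM pairs the four
    quotients so as to dominate 2z/x + 2w/y; multiplying by [x * y] leaves products of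
    neighbours. *)
Lemma second_difference_bound (R : realType) (c x y z w : R) : 0 <= c ->
  0 < w -> 0 < x -> 0 < y -> 0 < z -> x <= 2 * y -> y <= 2 * x ->
  z ^+ 2 / y ^+ 2 + x ^+ 2 / y ^+ 2 + y ^+ 2 / x ^+ 2 + w ^+ 2 / x ^+ 2
    <= 4 + 4 * c * (x ^- 2 + y ^- 2) ->
  y * z + w * x <= 2 * (x * y) + 8 * c.
Proof.
move=> c0 w0 x0 y0 z0 xy yx H.
have xn0 : x != 0 by rewrite gt_eqF.
have yn0 : y != 0 by rewrite gt_eqF.
have amgm1 : 2 * (z / x) <= z ^+ 2 / y ^+ 2 + y ^+ 2 / x ^+ 2.
  rewrite -subr_ge0.
  have -> : z ^+ 2 / y ^+ 2 + y ^+ 2 / x ^+ 2 - 2 * (z / x)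
            = (z / y - y / x) ^+ 2 by field; rewrite xn0 yn0.
  exact: sqr_ge0.
have amgm2 : 2 * (w / y) <= x ^+ 2 / y ^+ 2 + w ^+ 2 / x ^+ 2.
  rewrite -subr_ge0.
  have -> : x ^+ 2 / y ^+ 2 + w ^+ 2 / x ^+ 2 - 2 * (w / y)
            = (x / y - w / x) ^+ 2 by field; rewrite xn0 yn0.
  exact: sqr_ge0.
have {}H : 2 * (z / x) + 2 * (w / y) <= 4 + 4 * c * (x ^- 2 + y ^- 2) by lra.
have xy0 : 0 <= x * y by rewrite mulr_ge0 // ltW.
have := ler_wpM2r xy0 H.
have -> : (2 * (z / x) + 2 * (w / y)) * (x * y) = 2 * (y * z + w * x).
  by field; rewrite xn0 yn0.
have -> : (4 + 4 * c * (x ^- 2 + y ^- 2)) * (x * y)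
          = 4 * (x * y) + 4 * (c * (y / x + x / y)).
  by field; rewrite xn0 yn0.
(* Both ratios are at most 2, so the error is at most 16c, and halving gives 8c. *)
have : c * (y / x + x / y) <= c * 4.
  apply: ler_wpM2l => //.
  have : y / x <= 2 by rewrite ler_pdivrMr.
  have : x / y <= 2 by rewrite ler_pdivrMr.
  lra.
lra.
Qed.

(** Each slope exceeds the previous one by at most [D]; summing the slopes, 0 + 1 + ... + (n-1) is
    crudely bounded by n^2. *)
Lemma second_difference_growth (R : realType) (D : R) (g : nat -> R) :
  0 <= D -> (forall n, g n.+2 + g n <= 2 * g n.+1 + D) ->
  forall n, g n <= g 0%N + n%:R * `|g 1%N - g 0%N| + n%:R ^+ 2 * D.
Proof.
move=> D0 H.
have slope n : g n.+1 - g n <= `|g 1%N - g 0%N| + n%:R * D.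
  elim: n => [|n IH]; first by rewrite mul0r addr0 ler_norm.
  have := H n; rewrite -natr1; lra.
elim=> [|n IH]; first by rewrite !expr2 !mul0r !addr0.
have := slope n; rewrite -natr1.
have : 0 <= n%:R * D by rewrite mulr_ge0.
nra.
Qed.

(** Serves both regimes at once: the quadratic term vanishes when [K] is 0. *)
Lemma CD_weight_bound (R : realType) (G : weighted_graph R nat) (K : R) :
  physical G -> linear_graph G -> K <= 0 -> CD G K +oo%E ->
  exists2 M : R, 0 < M & forall n : nat, (2 <= n)%N ->
    wt G n n.+1 <= M * n%:R - 16 * K * n%:R ^+ 2.
Proof.
move=> hphys hlin K0 hCD.
pose a n := wt G n n.+1.
have a0 n : 0 < a n by apply: wt_gt0; rewrite hlin eqxx.
(* The shift absorbs the curvature term: 4b - b' - b'' equals 4a - a' - a'' - 2K. *)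
pose b n := a n - K.
have b0 n : 0 < b n by rewrite /b; have := a0 n; lra.
have right_ge0 n : 0 <= 4 * b n.+2 - b n.+3 - b n.+1.
  rewrite -(pmulr_rge0 _ (a0 n.+2)).
  by have := CD_slopes _ _ K 1 0 n hphys hlin hCD; rewrite /b -!/(a _); nra.
have left_ge0 n : 0 <= 4 * b n.+1 - b n - b n.+2.
  rewrite -(pmulr_rge0 _ (a0 n.+1)).
  by have := CD_slopes _ _ K 0 1 n hphys hlin hCD; rewrite /b -!/(a _); nra.
pose h n := Num.sqrt (b n).
have h0 n : 0 < h n by rewrite sqrtr_gt0.
have hh n : h n ^+ 2 = b n by rewrite sqr_sqrtr // ltW.
have hle i j : b i <= 4 * b j -> h i <= 2 * h j.
  move=> bij; rewrite -(@ler_pXn2r _ 2) ?nnegrE //.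
  - by rewrite exprMn !hh; lra.
  - exact: ltW.
  - by rewrite mulr_ge0 // ltW.
have step n : h n.+2 * h n.+3 + h n * h n.+1
              <= 2 * (h n.+1 * h n.+2) + 8 * - K.
  apply: second_difference_bound => //; first by rewrite oppr_ge0.
  - by apply: hle; have := right_ge0 n; have := b0 n.+3; lra.
  - by apply: hle; have := left_ge0 n; have := b0 n; lra.
  rewrite !hh.
  (* Reciprocal slopes turn the diagonal terms into ratios of b's and the mixed term into -4, up to
     corrections in [K]. *)
  have := CD_slopes _ _ K (b n.+2)^-1 (b n.+1)^-1 n hphys hlin hCD.
  rewrite /= -!/(a _).
  have := right_ge0 n; have := left_ge0 n.
  have := b0 n.+1; have := b0 n.+2.
  have -> : a n = b n + K by rewrite /b subrK.
  have -> : a n.+1 = b n.+1 + K by rewrite /b subrK.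
  have -> : a n.+2 = b n.+2 + K by rewrite /b subrK.
  have -> : a n.+3 = b n.+3 + K by rewrite /b subrK.
  move: (b n) (b n.+1) (b n.+2) (b n.+3) => w x y z y0 x0 L Q test.
  have xn0 : x != 0 by rewrite gt_eqF.
  have yn0 : y != 0 by rewrite gt_eqF.
  have KL : 0 <= - K * (4 * x - w - y) / x ^+ 2.
    by rewrite divr_ge0 ?sqr_ge0 // mulr_ge0 // oppr_ge0.
  have KQ : 0 <= - K * (4 * y - z - x) / y ^+ 2.
    by rewrite divr_ge0 ?sqr_ge0 // mulr_ge0 // oppr_ge0.
  have KK : 0 <= K ^+ 2 / (x * y) by rewrite divr_ge0 ?sqr_ge0 // mulr_ge0 // ltW.
  rewrite -subr_ge0 in test; rewrite -subr_ge0.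
  set lhs := (X in 0 <= X) in test.
  (* Replacing each a by b + K leaves only corrections that are nonnegative by [KL], [KQ] and
     [KK]. *)
  have -> : 4 + 4 * - K * (x^-1 + y^-1) - (z / y + x / y + y / x + w / x)
    = lhs + - K * (4 * x - w - y) / x ^+ 2 + - K * (4 * y - z - x) / y ^+ 2
      + 4 * (K ^+ 2 / (x * y)) by rewrite /lhs; field; rewrite xn0 yn0.
  apply: addr_ge0; last exact: mulr_ge0.
  by apply: addr_ge0 => //; apply: addr_ge0.
have D0 : 0 <= 8 * - K by lra.
have growth := second_difference_growth R _ _ D0 step.
set g0 := h 0%N * h 1%N in growth; set e := `|_ - g0| in growth.
have g00 : 0 < g0 by rewrite mulr_gt0.
have e0 : 0 <= e by exact: normr_ge0.
exists (2 * (g0 + e)); first by lra.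
move=> [|[|n]] // _; rewrite -/(a n.+2).
(* Back from products to a single weight; the factor 2 turns 8 into the final 16. *)
have an : a n.+2 <= 2 * (h n.+1 * h n.+2).
  have : h n.+2 <= 2 * h n.+1.
    by apply: hle; have := left_ge0 n; have := b0 n; lra.
  have := hh n.+2; have := h0 n.+2; rewrite /b; nra.
have gn := growth n.+1.
apply: (le_trans an).
have n1 : 1 <= n.+1%:R :> R by rewrite ler1n.
rewrite -[n.+2%:R]natr1.
have KN : 0 <= - K * n.+1%:R by rewrite mulr_ge0 ?oppr_ge0.
nra.
Qed.

Theorem theorem1p5 (R : realType) (G : weighted_graph R nat)
    (hphys : physical G) (hlin : linear_graph G) :
  (CD G 0 +oo%E ->
     (fun n : nat => wt G n n.+1) =O_\oo (fun n : nat => n%:R : R)) /\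
  ((exists2 K : R, K < 0 & CD G K +oo%E) ->
     (fun n : nat => wt G n n.+1) =O_\oo (fun n : nat => n%:R ^+ 2 : R)).
Proof.
have wt0 n : 0 < wt G n n.+1 by apply: wt_gt0; rewrite hlin eqxx.
split.
  move=> hCD; have [M M0 HM] := CD_weight_bound _ _ _ hphys hlin (lexx 0) hCD.
  apply/eqO_exP; exists M => //; exists 2%N => // n /= n2.
  rewrite gtr0_norm // ger0_norm //.
  by have := HM n n2; rewrite mulr0 mul0r subr0.
move=> [K K0 hCD].
have [M M0 HM] := CD_weight_bound _ _ _ hphys hlin (ltW K0) hCD.
apply/eqO_exP; exists (M - 16 * K); first by lra.
exists 2%N => // n /= n2; rewrite gtr0_norm // ger0_norm ?sqr_ge0 //.
(* The linear term is absorbed using n <= n^2. *)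
apply: le_trans (HM n n2) _; rewrite mulrBl lerD2r ler_pM2l //.
by rewrite expr2 ler_peMr // ler1n ltnW.
Qed.
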